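(* Let $n,p\in\mathbb{N}$ and let $m$ be an even positive integer. Let $\mathcal{F}_l$, $l=0,1,\ldots,p$, be $m$th-order $n$-dimensional real symmetric tensors. Suppose that there exists a nonsingular real $n\times n$ matrix $P$ such that $P^m\mathcal{F}_l$, $l=0,1,\ldots,p$, are all essentially nonpositive tensors. Suppose also that there exists $x_0\in\mathbb{R}^n$ such that $\langle\mathcal{F}_l,x_0^{\otimes m}\rangle<0$ for all $l=1,\ldots,p$. Then the following statements are equivalent: (i) for every $x\in\mathbb{R}^n$, if $\langle\mathcal{F}_l,x^{\otimes m}\rangle\le 0$ for all $l=1,\ldots,p$, then $\langle\mathcal{F}_0,x^{\otimes m}\rangle\ge 0$; (ii) there exist $\lambda_l\ge 0$, $l=1,\ldots,p$, such that $\mathcal{F}_0+\sum_{l=1}^p\lambda_l\mathcal{F}_l\in\mathrm{SOS}_{m,n}$.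
   Context: $\mathbb{N}=\{1,2,\ldots\}$. An $m$th-order $n$-dimensional tensor is an array $\mathcal{A}=(\mathcal{A}_{i_1\cdots i_m})_{1\le i_1,\ldots,i_m\le n}$ of real numbers; it is symmetric if its entries are invariant under every permutation of the indices. $\langle \mathcal{A},\mathcal{B}\rangle=\sum_{i_1,\ldots,i_m=1}^n \mathcal{A}_{i_1\cdots i_m}\mathcal{B}_{i_1\cdots i_m}$. For $x\in\mathbb{R}^n$, $x^{\otimes m}$ is the tensor with entries $(x^{\otimes m})_{i_1\cdots i_m}=x_{i_1}\cdots x_{i_m}$. A tensor $\mathcal{A}$ is essentially nonpositive if $\mathcal{A}_{i_1\cdots i_m}\le 0$ for every $(i_1,\ldots,i_m)\notin\{(i,i,\ldots,i):1\le i\le n\}$. For a real $n\times n$ matrix $P=(P_{ij})$, $P^m\mathcal{A}$ denotes the $m$th-order $n$-dimensional tensor with entries $(P^m\mathcal{A})_{i_1\cdots i_m}=\sum_{j_1,\ldots,j_m=1}^n P_{i_1j_1}\cdots P_{i_mj_m}\mathcal{A}_{j_1\cdots j_m}$. $\mathrm{SOS}_{m,n}$ is the set of all $m$th-order $n$-dimensional symmetric tensors $\mathcal{A}$ such that the polynomial $x\mapsto\langle\mathcal{A},x^{\otimes m}\rangle$ on $\mathbb{R}^n$ is a sum of squares of finitely many real polynomials. *)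

(* Defs.v *)
From mathcomp Require Import all_boot all_order all_fingroup all_algebra.
From mathcomp Require Import reals.
From mathcomp Require mpoly.

Set Implicit Arguments.
Unset Strict Implicit.
Unset Printing Implicit Defensive.

Import GRing.Theory Num.Theory.
Local Open Scope ring_scope.

(* A multi-index (i_1, ..., i_m) is a finite function 'I_m -> 'I_n, so tensors
   inherit entrywise addition from {ffun _ -> R}. *)
Notation tindex m n := {ffun 'I_m -> 'I_n}.
Notation tensor R m n := {ffun tindex m n -> R}.

Definition tsymmetric (R : realType) (m n : nat) (A : tensor R m n) : Prop :=
  forall (s : 'S_m) (i : tindex m n), A [ffun k => i (s k)] = A i.

Definition tscale (R : realType) (m n : nat) (c : R) (A : tensor R m n) :
    tensor R m n :=
  [ffun i : tindex m n => c * A i].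

Definition tdot (R : realType) (m n : nat) (A B : tensor R m n) : R :=
  \sum_(i : tindex m n) A i * B i.

Definition tpow (R : realType) (m n : nat) (x : 'rV[R]_n) : tensor R m n :=
  [ffun i : tindex m n => \prod_(k < m) x ord0 (i k)].

Definition essentially_nonpositive (R : realType) (m n : nat)
    (A : tensor R m n) : Prop :=
  forall i : tindex m n, ~ (exists a : 'I_n, i = [ffun=> a]) -> A i <= 0.

Definition tmul (R : realType) (m n : nat) (P : 'M[R]_n) (A : tensor R m n) :
    tensor R m n :=
  [ffun i : tindex m n =>
     \sum_(j : tindex m n) (\prod_(k < m) P (i k) (j k)) * A j].

(* [mpoly.mpoly n R] is the type of polynomials in n variables over R, and
   [mpoly.meval v q] is the value of q at v; the notations of mpoly are not
   imported because they clash with those of MathComp-Analysis. *)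
Definition SOS (R : realType) (m n : nat) (A : tensor R m n) : Prop :=
  tsymmetric A /\
  exists s : seq (mpoly.mpoly n R), forall x : 'rV[R]_n,
    tdot A (tpow m x) = \sum_(q <- s) mpoly.meval (x ord0) q ^+ 2.

(* Main.v *)
(* After the change of variables by [P] all forms are essentially nonpositive.
   On the nonnegative orthant such a form is convex in the variables
   [z_a = y_a ^ m], since its off-diagonal monomials are geometric means, and
   replacing [y] by [|y|] does not increase it; so convex Lagrange duality
   under Slater's condition provides the multipliers.  It remains to see that
   an essentially nonpositive form which is nonnegative is a sum of squares:
   at a minimizer on [sum_a y_a ^ m = 1], the first-order conditions write the
   form as a nonnegative combination of even powers and of scaled AM-GM forms
   [sum_k t_k ^ m - m prod_k t_k], which are sums of squares by Hurwitz. *)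
Require Import Defs.
From mathcomp Require Import all_boot all_order all_fingroup all_algebra.
From mathcomp Require Import ring lra.
From mathcomp Require Import boolp classical_sets.
From mathcomp Require Import reals topology normedtype derive exp.
From mathcomp Require Import -(notations) mpoly.

Set Implicit Arguments.
Unset Strict Implicit.
Unset Printing Implicit Defensive.

Import Order.TTheory GRing.Theory Num.Theory.
Import numFieldNormedType.Exports.
Local Open Scope ring_scope.

(** * Polynomial functions and sums of squares *)

(** Polynomials are handled through their values, as in [SOS], so that every identity below is
    checked pointwise in [R]. *)
Definition polyfun (R : realType) (N : nat) (f : 'rV[R]_N -> R) : Prop :=
  exists q : mpoly N R, forall x, f x = meval (x ord0) q.

Definition sosfun (R : realType) (N : nat) (f : 'rV[R]_N -> R) : Prop :=
  exists s : seq (mpoly N R), forall x,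
    f x = \sum_(q <- s) meval (x ord0) q ^+ 2.

Section SumsOfSquares.
Variables (R : realType) (N : nat).
Implicit Types f g : 'rV[R]_N -> R.

Lemma polyfun_coord (a : 'I_N) : polyfun (fun x : 'rV[R]_N => x ord0 a).
Proof. by exists (mpolyX _ (mnm1 a)) => x; rewrite mevalXU. Qed.

Lemma polyfun_cst (c : R) : polyfun (fun _ : 'rV[R]_N => c).
Proof. by exists (mpolyC N c) => x; rewrite mevalC. Qed.

Lemma polyfunD f g : polyfun f -> polyfun g -> polyfun (fun x => f x + g x).
Proof.
by move=> [p fp] [q gq]; exists (p + q) => x; rewrite mevalD fp gq.
Qed.

Lemma polyfunB f g : polyfun f -> polyfun g -> polyfun (fun x => f x - g x).
Proof.
by move=> [p fp] [q gq]; exists (p - q) => x; rewrite mevalB fp gq.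
Qed.

Lemma polyfunM f g : polyfun f -> polyfun g -> polyfun (fun x => f x * g x).
Proof.
by move=> [p fp] [q gq]; exists (p * q) => x; rewrite mevalM fp gq.
Qed.

Lemma polyfunX f k : polyfun f -> polyfun (fun x => f x ^+ k).
Proof.
move=> pf; elim: k => [|k IHk]; first by exists 1 => x; rewrite meval1.
by have [p pE] := polyfunM pf IHk; exists p => x; rewrite exprS pE.
Qed.

Lemma polyfun_sum I (r : seq I) (P : pred I) (f : I -> 'rV[R]_N -> R) :
  (forall i, P i -> polyfun (f i)) ->
  polyfun (fun x => \sum_(i <- r | P i) f i x).
Proof.
move=> pf; elim: r => [|i r [q IHr]].
  by exists 0 => x; rewrite big_nil meval0.
have [Pi|nPi] := boolP (P i); last first.
  by exists q => x; rewrite big_cons (negbTE nPi).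
have [p fp] := pf _ Pi; exists (p + q) => x.
by rewrite big_cons Pi mevalD fp IHr.
Qed.

Lemma polyfun_prod I (r : seq I) (P : pred I) (f : I -> 'rV[R]_N -> R) :
  (forall i, P i -> polyfun (f i)) ->
  polyfun (fun x => \prod_(i <- r | P i) f i x).
Proof.
move=> pf; elim: r => [|i r [q IHr]].
  by exists 1 => x; rewrite big_nil meval1.
have [Pi|nPi] := boolP (P i); last first.
  by exists q => x; rewrite big_cons (negbTE nPi).
have [p fp] := pf _ Pi; exists (p * q) => x.
by rewrite big_cons Pi mevalM fp IHr.
Qed.

Lemma sosfun_sqr f : polyfun f -> sosfun (fun x => f x ^+ 2).
Proof. by move=> [p fp]; exists [:: p] => x; rewrite big_seq1 fp. Qed.

Lemma sosfun_polyfun f : sosfun f -> polyfun f.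
Proof.
move=> [s fs]; exists (\sum_(q <- s) q * q) => x; rewrite fs.
elim: s {fs} => [|q s IHs]; first by rewrite !big_nil meval0.
by rewrite !big_cons IHs mevalD mevalM expr2.
Qed.

Lemma eq_sosfun f g : f =1 g -> sosfun f -> sosfun g.
Proof. by move=> fg [s fs]; exists s => x; rewrite -fg. Qed.

Lemma sosfun0 : sosfun (fun _ : 'rV[R]_N => 0).
Proof. by exists [::] => x; rewrite big_nil. Qed.

Lemma sosfunD f g : sosfun f -> sosfun g -> sosfun (fun x => f x + g x).
Proof. by move=> [s fs] [t gt]; exists (s ++ t) => x; rewrite big_cat fs gt. Qed.

Lemma sosfun_sum I (r : seq I) (P : pred I) (f : I -> 'rV[R]_N -> R) :
  (forall i, P i -> sosfun (f i)) ->
  sosfun (fun x => \sum_(i <- r | P i) f i x).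
Proof.
move=> pf; elim: r => [|i r IHr].
  by apply: eq_sosfun sosfun0 => x; rewrite big_nil.
have [Pi|nPi] := boolP (P i).
  by apply: eq_sosfun (sosfunD (pf _ Pi) IHr) => x; rewrite big_cons Pi.
by apply: eq_sosfun IHr => x; rewrite big_cons (negbTE nPi).
Qed.

Lemma sosfun_cst (c : R) : 0 <= c -> sosfun (fun _ : 'rV[R]_N => c).
Proof.
move=> c_ge0; apply: eq_sosfun (sosfun_sqr (polyfun_cst (Num.sqrt c))) => x.
by rewrite sqr_sqrtr.
Qed.

Lemma sosfunM f g : sosfun f -> sosfun g -> sosfun (fun x => f x * g x).
Proof.
move=> [s fs] [t gt].
apply: (@eq_sosfun (fun x => \sum_(p <- s) \sum_(q <- t)
    (meval (x ord0) p * meval (x ord0) q) ^+ 2)).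
  move=> x; rewrite fs gt mulr_suml; apply: eq_bigr => p _.
  by rewrite mulr_sumr; apply: eq_bigr => q _; rewrite exprMn.
apply: sosfun_sum => p _; apply: sosfun_sum => q _.
by apply/sosfun_sqr/polyfunM; [exists p | exists q].
Qed.

Lemma sosfunX f k : sosfun f -> sosfun (fun x => f x ^+ k).
Proof.
move=> sf; elim: k => [|k IHk].
  by apply: eq_sosfun (sosfun_cst ler01) => x.
by apply: eq_sosfun (sosfunM sf IHk) => x; rewrite exprS.
Qed.

Lemma sosfun_scale (c : R) f : 0 <= c -> sosfun f -> sosfun (fun x => c * f x).
Proof. by move=> c0; apply: sosfunM; apply: sosfun_cst. Qed.

(* Induction on [r], from
   2r D_(r+1)(X) = sum_(a, k) (X_k - X_a) (X_k^r - X_a^r)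
                   + 2 sum_a X_a D_r(X without X_a),
   where D_r(X) = sum_k X_k^r - r prod_k X_k. *)
Lemma sosfun_amgm r (X : 'I_r -> 'rV[R]_N -> R) :
  (forall k, sosfun (X k)) ->
  sosfun (fun x => \sum_k X k x ^+ r - r%:R * \prod_k X k x).
Proof.
elim: r X => [|r IHr] X sX.
  by apply: eq_sosfun sosfun0 => x; rewrite big_ord0 mul0r subr0.
(* The identity yields the form multiplied by 2r, so r = 0 is treated apart before dividing. *)
have [r0|r_gt0] := posnP r.
  subst r; apply: eq_sosfun sosfun0 => x.
  by rewrite !big_ord1 mul1r expr1 subrr.
have r_neq0 : r%:R != 0 :> R by rewrite pnatr_eq0 -lt0n.
pose E x := \sum_a \sum_k (X k x - X a x) * (X k x ^+ r - X a x ^+ r).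
pose D (a : 'I_r.+1) x := \sum_(k < r) X (lift a k) x ^+ r
  - r%:R * \prod_(k < r) X (lift a k) x.
have sE : sosfun E.
  apply: sosfun_sum => a _; apply: sosfun_sum => k _.
  (* Factoring X_k^r - X_a^r by X_k - X_a leaves a square times a sum of products of the X's. *)
  apply: (@eq_sosfun (fun x => (X k x - X a x) ^+ 2 *
      \sum_(i < r) X k x ^+ (r.-1 - i) * X a x ^+ i)).
    by move=> x; rewrite subrXX mulrA expr2.
  apply: sosfunM; first by apply/sosfun_sqr/polyfunB; apply: sosfun_polyfun.
  by apply: sosfun_sum => i _; apply: sosfunM; apply: sosfunX.
have sD : sosfun (fun x => \sum_a X a x * D a x).
  by apply: sosfun_sum => a _; apply: sosfunM => //; apply: IHr.
have c0 : 0 <= (2 * r%:R)^-1 :> R by rewrite invr_ge0 mulr_ge0 ?ler0n.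
apply: eq_sosfun (sosfun_scale c0 (sosfunD sE (sosfun_scale (ler0n R 2) sD))) => x.
pose S j := \sum_k X k x ^+ j.
have DE a : X a x * D a x =
    X a x * S r - X a x ^+ r.+1 - r%:R * \prod_k X k x.
  rewrite /D /S (bigD1_ord a) //= [in RHS](bigD1_ord a) //= exprS; ring.
have EE : E x = 2 * r.+1%:R * S r.+1 - 2 * (S 1%N * S r).
  have -> : E x = \sum_a (S r.+1 - S 1%N * X a x ^+ r - X a x * S r
      + r.+1%:R * X a x ^+ r.+1).
    apply: eq_bigr => a _.
    rewrite /S mulr_suml mulr_sumr -!sumrB.
    have -> : r.+1%:R * X a x ^+ r.+1 = \sum_(k < r.+1) X a x ^+ r.+1.
      by rewrite sumr_const card_ord mulr_natl.
    by rewrite -big_split; apply: eq_bigr => k _ /=; rewrite !exprS; ring.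
  rewrite big_split /= !sumrB sumr_const card_ord -mulr_sumr -mulr_suml.
  rewrite -[in X in _ + X]mulr_sumr.
  have -> : \sum_a X a x = S 1%N by apply: eq_bigr.
  by rewrite -/(S r) -/(S r.+1) -mulr_natl; ring.
have -> : \sum_a X a x * D a x =
    S 1%N * S r - S r.+1 - r.+1%:R * (r%:R * \prod_k X k x).
  rewrite (eq_bigr _ (fun a _ => DE a)) !sumrB sumr_const card_ord -mulr_suml.
  by rewrite -[X in _ - X]mulr_natl; congr (_ * _ - _ - _); apply: eq_bigr.
by rewrite EE -/(S r.+1) -natr1; field.
Qed.

(* With [u] and [v] the products of the two halves of the family,
   [u v = (u^2 + v^2 - (u - v)^2) / 2], which leaves an instance of
   [sosfun_amgm] for the squares. *)
Lemma sosfun_hurwitz m (t : 'I_m -> 'rV[R]_N -> R) :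
  ~~ odd m -> (forall k, polyfun (t k)) ->
  sosfun (fun x => \sum_k t k x ^+ m - m%:R * \prod_k t k x).
Proof.
move=> m_even; have [r def_m] : exists r, m = (r + r)%N.
  by exists m./2; rewrite addnn even_halfK.
subst m => pt.
pose u x := \prod_(k < r) t (lshift r k) x.
pose v x := \prod_(k < r) t (rshift r k) x.
have su : sosfun (fun x => \sum_(k < r) (t (lshift r k) x ^+ 2) ^+ r
    - r%:R * \prod_(k < r) t (lshift r k) x ^+ 2).
  by apply: sosfun_amgm => k; apply: sosfun_sqr.
have sv : sosfun (fun x => \sum_(k < r) (t (rshift r k) x ^+ 2) ^+ r
    - r%:R * \prod_(k < r) t (rshift r k) x ^+ 2).
  by apply: sosfun_amgm => k; apply: sosfun_sqr.
(* The weight is r because m u v = 2r u v = r u^2 + r v^2 - r (u - v)^2. *)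
have suv : sosfun (fun x => r%:R * (u x - v x) ^+ 2).
  apply: sosfun_scale; first exact: ler0n.
  by apply/sosfun_sqr/polyfunB; apply: polyfun_prod.
apply: eq_sosfun (sosfunD (sosfunD su sv) suv) => x.
rewrite !prodrXl -/(u x) -/(v x) big_split_ord [in RHS]big_split_ord /=.
rewrite -/(u x) -/(v x) natrD.
under eq_bigr do rewrite -exprM mul2n -addnn.
under [X in _ + (X - _) + _]eq_bigr do rewrite -exprM mul2n -addnn.
ring.
Qed.

End SumsOfSquares.

Lemma sosfun_ge0 (R : realType) N (f : 'rV[R]_N -> R) x : sosfun f -> 0 <= f x.
Proof. by move=> [s ->]; apply: sumr_ge0 => q _; apply: sqr_ge0. Qed.

(** * Lagrange multipliers *)

(* The constraints are eliminated one at a time; the multiplier of the first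
   one is the infimum of [- f0 / f1] over the points that satisfy the others
   and make [f1] negative. *)
Lemma convexlike_multipliers (R : realType) (T : Type) (p : nat)
    (f0 : T -> R) (f : 'I_p -> T -> R) :
  (forall s t y z, 0 <= s -> 0 <= t -> exists w,
     f0 w <= s * f0 y + t * f0 z /\
     forall l, f l w <= s * f l y + t * f l z) ->
  (exists y, forall l, f l y < 0) ->
  (forall y, (forall l, f l y <= 0) -> 0 <= f0 y) ->
  exists lambda : 'I_p -> R, (forall l, 0 <= lambda l) /\
    forall y, 0 <= f0 y + \sum_l lambda l * f l y.
Proof.
elim: p f0 f => [|p IHp] f0 f cvx [y0 y0_lt0] f0_ge0.
  exists (fun=> 0); split=> [//|y].
  by rewrite big_ord0 addr0; apply: f0_ge0 => -[].
pose f1 := f ord0; pose f' l := f (lift ord0 l).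
pose D := [set y | (forall l, f' l y <= 0) /\ f1 y < 0]%classic.
pose E := [set f0 y / - f1 y | y in D]%classic.
have f0_ge0' y : (forall l, f' l y <= 0) -> f1 y <= 0 -> 0 <= f0 y.
  move=> f'y f1y; apply: f0_ge0 => l.
  by case: (unliftP ord0 l) => [j|] ->; [apply: f'y | apply: f1y].
have E_ge0 : lbound E 0.
  move=> _ [y [f'y f1y] <-]; rewrite divr_ge0 ?oppr_ge0 ?(ltW f1y) //.
  by apply: f0_ge0' => //; apply: ltW.
(* The Slater point makes [inf E] a genuine infimum rather than a default value. *)
have E_neq0 : (E !=set0)%classic.
  exists (f0 y0 / - f1 y0); exists y0; last by [].
  by split=> [l|]; [apply/ltW|]; apply: y0_lt0.
pose mu := inf E.
have mu_ge0 : 0 <= mu by apply: lb_le_inf.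
have f01_ge0 y : (forall l, f' l y <= 0) -> 0 <= f0 y + mu * f1 y.
  move=> f'y; case: (ltgtP (f1 y) 0) => [f1y|f1y|f1y]; last first.
  - by rewrite f1y mulr0 addr0; apply: f0_ge0' => //; rewrite f1y.
  - suff : - f0 y / f1 y <= mu by rewrite ler_pdivrMr // addrC -lerBlDr sub0r.
    apply: lb_le_inf => // _ [z [f'z f1z] <-].
    have f1z' : 0 < - f1 z by rewrite oppr_gt0.
    (* The weights [- f1 z] and [f1 y] cancel the bound on [f1 w]; so [w] is feasible, and
       [0 <= f0 w] gives the comparison of the two quotients. *)
    have [w [f0w fw]] := cvx _ _ y z (ltW f1z') (ltW f1y).
    rewrite ler_pdivrMr // mulrAC ler_pdivlMr //.
    suff : 0 <= f0 w by move: f0w; nra.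
    apply: f0_ge0' => [l|]; last by apply: le_trans (fw ord0) _; rewrite -/f1; lra.
    apply: le_trans (fw (lift ord0 l)) _; rewrite -/(f' l).
    by have := f'y l; have := f'z l; nra.
  - suff : mu <= f0 y / - f1 y.
      by rewrite ler_pdivlMr ?oppr_gt0 // mulrN lerNl -subr_ge0 opprK addrC.
    by apply: ge_inf; [exists 0 | exists y].
have cvx' s t y z : 0 <= s -> 0 <= t -> exists w,
    f0 w + mu * f1 w <= s * (f0 y + mu * f1 y) + t * (f0 z + mu * f1 z) /\
    forall l, f' l w <= s * f' l y + t * f' l z.
  move=> s0 t0; have [w [f0w fw]] := cvx _ _ y z s0 t0.
  exists w; split=> [|l]; last exact: fw.
  have := ler_wpM2l mu_ge0 (fw ord0); rewrite -/f1; move: f0w; lra.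
have slater' : exists y, forall l, f' l y < 0 by exists y0 => l; apply: y0_lt0.
have [nu [nu_ge0 nuP]] := IHp _ f' cvx' slater' f01_ge0.
exists (fun l => if unlift ord0 l is Some j then nu j else mu); split=> [l|y].
  by case: unliftP.
rewrite big_ord_recl unlift_none addrA.
by under eq_bigr do rewrite liftK; apply: nuP.
Qed.

(** * Roots, geometric means and Fermat's rule *)

Lemma exists_root_nneg (R : realType) m (x : R) :
  (0 < m)%N -> 0 <= x -> exists2 r, 0 <= r & r ^+ m = x.
Proof.
move=> m_gt0 x_ge0; exists (x `^ (m%:R^-1)); first exact: powR_ge0.
by rewrite -powR_mulrn ?powR_ge0 // -powRrM mulVf ?powRr1 // pnatr_eq0 -lt0n.
Qed.

(** This is [sosfun_amgm] for constants in zero variables: nonnegative constants are squares. *)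
Lemma amgm_prod (R : realType) m (u : 'I_m -> R) :
  (forall k, 0 <= u k) -> m%:R * \prod_k u k <= \sum_k u k ^+ m.
Proof.
move=> u_ge0; rewrite -subr_ge0.
apply: (sosfun_ge0 (0 : 'rV[R]_0)
  (f := fun=> \sum_k u k ^+ m - m%:R * \prod_k u k)).
by apply: (@sosfun_amgm R 0 m (fun k _ => u k)) => k; apply: sosfun_cst.
Qed.

(** Superadditivity of the geometric mean: divide by the product of the [w k] and add AM-GM for the
    ratios u/w and v/w with weights [s] and [t]. *)
Lemma prod_mean_concave (R : realType) m (s t : R) (u v w : 'I_m -> R) :
  (0 < m)%N -> 0 <= s -> 0 <= t ->
  (forall k, 0 <= u k) -> (forall k, 0 <= v k) -> (forall k, 0 <= w k) ->
  (forall k, w k ^+ m = s * u k ^+ m + t * v k ^+ m) ->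
  s * \prod_k u k + t * \prod_k v k <= \prod_k w k.
Proof.
move=> m_gt0 s_ge0 t_ge0 u_ge0 v_ge0 w_ge0 wE.
have [[k wk0]|w_neq0] := pselect (exists k, w k = 0).
  (* A zero [w k] forces [s * u k] and [t * v k] to vanish, so both sides are zero. *)
  have := wE k; rewrite wk0 expr0n eqn0Ngt m_gt0 /= => /esym/eqP.
  rewrite paddr_eq0 ?mulr_ge0 ?exprn_ge0 // !mulf_eq0 !expf_eq0 m_gt0 /=.
  move=> /andP[/orP su /orP tv]; rewrite (bigD1 k) //= [\prod_k v k](bigD1 k) //=.
  rewrite [\prod_k w k](bigD1 k) //= wk0 mul0r !mulrA.
  have -> : s * u k = 0 by case: su => /eqP ->; rewrite ?mul0r ?mulr0.
  have -> : t * v k = 0 by case: tv => /eqP ->; rewrite ?mul0r ?mulr0.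
  by rewrite !mul0r addr0.
have w_gt0 k : 0 < w k.
  by rewrite lt0r w_ge0 andbT; apply/eqP => wk0; apply: w_neq0; exists k.
have W_gt0 : 0 < \prod_k w k by apply: prodr_gt0.
have m_gt0' : 0 < m%:R :> R by rewrite ltr0n.
have Pu : m%:R * \prod_k (u k / w k) <= \sum_k (u k / w k) ^+ m.
  by apply: amgm_prod => k; rewrite divr_ge0.
have Pv : m%:R * \prod_k (v k / w k) <= \sum_k (v k / w k) ^+ m.
  by apply: amgm_prod => k; rewrite divr_ge0.
(* By [wE] each k contributes exactly 1. *)
have sumE : s * (\sum_k (u k / w k) ^+ m) + t * (\sum_k (v k / w k) ^+ m) = m%:R.
  rewrite !mulr_sumr -big_split /= -[RHS]mulr1n -[X in X%:R *+ _]card_ord.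
  rewrite mulr1n -sumr_const; apply: eq_bigr => k _.
  rewrite !expr_div_n !mulrA -mulrDl -wE divff // expf_neq0 //.
  exact: lt0r_neq0.
have := lerD (ler_wpM2l s_ge0 Pu) (ler_wpM2l t_ge0 Pv); rewrite sumE.
rewrite !prodf_div ![_ * (m%:R * _)]mulrCA -mulrDr.
rewrite -[X in _ <= X]mulr1 ler_pM2l // !mulrA -mulrDl ler_pdivrMr //.
by rewrite mul1r.
Qed.

Lemma poly_min_deriv (R : realType) (q : {poly R}) (c : R) :
  (forall s, q.[c] <= q.[s]) -> q^`()%R.[c] = 0.
Proof.
move=> qmin; rewrite derivE derive1E; apply: derive_val.
apply: (@derive1_at_min R _ (c - 1) (c + 1)); first by lra.
- by move=> t _; apply: derivable_horner.
- by rewrite in_itv /=; lra.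
- by move=> t _; apply: qmin.
Qed.

(** * Forms of tensors on the nonnegative orthant *)

(** Coordinate functions replace row vectors, which makes absolute values, rescaling and restriction
    of coordinates direct. *)
Definition tform (R : realType) (m n : nat) (A : tensor R m n)
    (y : 'I_n -> R) : R :=
  \sum_(i : tindex m n) A i * \prod_k y (i k).

Section TensorForms.
Variables (R : realType) (m n : nat).
Hypotheses (m_gt0 : (0 < m)%N) (m_even : ~~ odd m).
Implicit Types (A B : tensor R m n) (y z : 'I_n -> R).

Lemma tdot_tpow A (x : 'rV[R]_n) : tdot A (tpow m x) = tform A (x ord0).
Proof. by apply: eq_bigr => i _; rewrite ffunE. Qed.

Lemma eq_tform A y z : y =1 z -> tform A y = tform A z.
Proof.
by move=> yz; apply: eq_bigr => i _; under eq_bigr do rewrite yz.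
Qed.

Lemma tform_scale A (c : R) y : tform A (fun a => c * y a) = c ^+ m * tform A y.
Proof.
rewrite /tform mulr_sumr; apply: eq_bigr => i _.
by rewrite big_split /= prodr_const card_ord mulrCA.
Qed.

Lemma offdiag_le0 A (i : tindex m n) (k l : 'I_m) :
  essentially_nonpositive A -> i k != i l -> A i <= 0.
Proof.
by move=> An ikl; apply: An => -[a ia]; case/eqP: ikl; rewrite ia !ffunE.
Qed.

Lemma prod_diag y (a : 'I_n) :
  \prod_(k < m) y ([ffun=> a] k : 'I_n) = y a ^+ m.
Proof. by under eq_bigr do rewrite ffunE; rewrite prodr_const card_ord. Qed.

(** The sum of the m-th tensor powers of the basis vectors indexed by [S]; its form defines the l^m
    unit sphere on these coordinates. *)
Definition tdiag (S : {set 'I_n}) : tensor R m n :=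
  [ffun i : tindex m n => \sum_(a in S) (i == [ffun=> a])%:R].

Lemma tform_tdiag (S : {set 'I_n}) y : tform (tdiag S) y = \sum_(a in S) y a ^+ m.
Proof.
rewrite /tform; under eq_bigr do rewrite ffunE mulr_suml.
rewrite exchange_big; apply: eq_bigr => a _ /=.
rewrite (bigD1 [ffun=> a]) //= eqxx mul1r prod_diag big1 ?addr0 //.
by move=> i /negbTE ->; rewrite mul0r.
Qed.

(** Diagonal monomials are even powers and do not change; the others can only grow in absolute
    value, and their coefficients are nonpositive. *)
Lemma tform_norm A y : essentially_nonpositive A ->
  tform A (fun a => `|y a|) <= tform A y.
Proof.
move=> An; apply: ler_sum => i _; rewrite -normr_prod.
have [[a ->]|nd] := pselect (exists a : 'I_n, i = [ffun=> a]).
  by rewrite !prod_diag ger0_norm // exprn_even_ge0.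
by apply: ler_wnM2l (ler_norm _); apply: An.
Qed.

(* In the variables [z_a = y_a ^ m] on the nonnegative orthant, the form is
   convex: its off-diagonal monomials are geometric means with nonpositive
   coefficients. *)
Lemma tform_convexlike (I : Type) (A : I -> tensor R m n) (s t : R) y z :
  (forall l, essentially_nonpositive (A l)) -> 0 <= s -> 0 <= t ->
  (forall a, 0 <= y a) -> (forall a, 0 <= z a) ->
  exists2 w, (forall a, 0 <= w a) &
    forall l, tform (A l) w <= s * tform (A l) y + t * tform (A l) z.
Proof.
move=> An s_ge0 t_ge0 y_ge0 z_ge0.
have wP a : exists r, 0 <= r /\ r ^+ m = s * y a ^+ m + t * z a ^+ m.
  have [|r r_ge0 rE] := @exists_root_nneg R m (s * y a ^+ m + t * z a ^+ m) m_gt0.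
    by rewrite addr_ge0 ?mulr_ge0 ?exprn_ge0.
  by exists r.
have [w {}wP] := choice wP.
exists w => [a|l]; first by case: (wP a).
rewrite /tform !mulr_sumr -big_split /=; apply: ler_sum => i _.
rewrite ![_ * (A l i * _)]mulrCA -mulrDr.
have [[a ->]|nd] := pselect (exists a : 'I_n, i = [ffun=> a]).
  by rewrite !prod_diag; case: (wP a) => _ ->.
apply: ler_wnM2l; first exact: An.
by apply: prod_mean_concave => // k; case: (wP (i k)).
Qed.

(** * Minimization on the l^m sphere *)

Lemma continuous_tform A : continuous (fun x : 'rV[R]_n => tform A (x ord0)).
Proof.
apply: continuous_big => [|i _]; first exact: add_continuous.
move=> x; apply: continuousM; first exact: cst_continuous.
move: x; apply: continuous_big => [|k _]; first exact: mul_continuous.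
exact: coord_continuous.
Qed.

Local Open Scope classical_set_scope.

(** Extreme value theorem: since [m] is even, sphere points have coordinates in [-1, 1], so the
    sphere is a closed part of a compact box. *)
Lemma tform_min A (S : {set 'I_n}) a0 : a0 \in S ->
  exists y, [/\ forall a, a \notin S -> y a = 0, \sum_(a in S) y a ^+ m = 1 &
    forall z, (forall a, a \notin S -> z a = 0) ->
      \sum_(a in S) z a ^+ m = 1 -> tform A y <= tform A z].
Proof.
move=> a0S; pose I a : set R := if a \in S then `[-1, 1] else [set 0].
pose K := [set x : 'rV[R]_n | forall a, I a (x ord0 a)] `&`
  (fun x => \sum_(a in S) x ord0 a ^+ m) @^-1` [set x | x = 1].
have Kz z : (forall a, a \notin S -> z a = 0) -> \sum_(a in S) z a ^+ m = 1 ->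
    K (\row_a z a).
  move=> zS z1; split=> [a|] /=; last first.
    by rewrite -[RHS]z1; apply: eq_bigr => a _; rewrite mxE.
  rewrite /I mxE; case: ifPn => [aS|/zS //] /=.
  rewrite in_itv /= -ler_norml -(@ler_pXn2r _ m) ?nnegrE //.
  rewrite expr1n -normrX ger0_norm ?exprn_even_ge0 // -z1.
  by rewrite (bigD1 a) //= lerDl sumr_ge0 // => b _; rewrite exprn_even_ge0.
have cK : compact K.
  apply: compact_closedI; last first.
    apply: closed_comp; last exact: closed_eq.
    have -> : (fun x : 'rV[R]_n => \sum_(a in S) x ord0 a ^+ m) =
        (fun x : 'rV[R]_n => tform (tdiag S) (x ord0)).
      by apply: funext => x; rewrite tform_tdiag.
    by move=> x _; apply: continuous_tform.
  apply: rV_compact => a; rewrite /I; case: ifP => _; first exact: segment_compact.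
  exact: compact_set1.
have K0 : K !=set0.
  exists (\row_a (a == a0)%:R); apply: Kz => [a|].
    by case: eqP => // ->; rewrite a0S.
  rewrite (bigD1 a0) //= eqxx expr1n big1 ?addr0 // => a /andP[_ /negbTE ->].
  by rewrite expr0n eqn0Ngt m_gt0.
have cf : {within K, continuous (fun x : 'rV[R]_n => tform A (x ord0))}.
  by apply: continuous_subspaceT; apply: continuous_tform.
have [x xK xmin] := EVT_min_rV K0 cK cf.
move: xK; rewrite inE => -[xI x1].
exists (x ord0); split=> // [a aS|z zS z1].
  by have := xI a; rewrite /I (negbTE aS).
have := xmin (\row_a z a); rewrite inE => /(_ (Kz _ zS z1)).
by rewrite (@eq_tform A ((\row_a z a) ord0) z) // => a; rewrite mxE.
Qed.

Local Close Scope classical_set_scope.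

(** * Zeros of nonnegative forms and sums of squares *)

(** The exponent of the variable [a] in the monomial of [i]. *)
Definition deg_in (a : 'I_n) (i : tindex m n) : nat := \sum_k (i k == a).

(* Euler-type first-order condition, from scaling the coordinate [a]. *)
Lemma tform_critical A y0 : (forall y, 0 <= tform A y) -> tform A y0 = 0 ->
  forall a, \sum_i (A i * \prod_k y0 (i k)) *+ deg_in a i = 0.
Proof.
move=> A_ge0 Ay0 a.
(* [q] is the form along s, with coordinate [a] of [y0] multiplied by s; its minimum 0 is reached at
   s = 1. *)
pose q : {poly R} := \sum_i (A i * \prod_k y0 (i k)) *: 'X^(deg_in a i).
have qE s : q.[s] = tform A (fun b => if b == a then s * y0 b else y0 b).
  rewrite horner_sum; apply: eq_bigr => i _.
  rewrite hornerZ hornerXn -mulrA; congr (_ * _).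
  rewrite /deg_in -prodrXr -big_split /=; apply: eq_bigr => k _.
  by case: eqP => _; rewrite ?expr1 ?mulr1 // mulrC.
have q1 : q.[1] = 0.
  by rewrite qE -[RHS]Ay0; apply: eq_tform => b; case: eqP; rewrite ?mul1r.
transitivity q^`()%R.[1]; last by apply: poly_min_deriv => s; rewrite q1 qE.
rewrite /q (big_morph _ (@derivD R) (@deriv0 R)) horner_sum.
apply: eq_bigr => i _.
by rewrite derivZ derivXn hornerZ hornerMn hornerXn expr1n mulrnAr mulr1.
Qed.

(** Raise the zero coordinates of [y0] to a small e. Monomials off the support cost O(e^m), while a
    negative mixed entry gains at least order e^(m-1), so the form would become negative. *)
Lemma tform_no_mixed A y0 (i0 : tindex m n) (k1 k2 : 'I_m) :
  essentially_nonpositive A -> (forall y, 0 <= tform A y) ->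
  (forall a, 0 <= y0 a) -> tform A y0 = 0 ->
  y0 (i0 k1) != 0 -> y0 (i0 k2) = 0 -> A i0 = 0.
Proof.
move=> An A_ge0 y0_ge0 Ay0 y0k1 y0k2.
have Ai0_le0 : A i0 <= 0.
  by apply: (@offdiag_le0 _ _ k1 k2) => //; apply: contraNneq y0k1 => ->; apply/eqP.
apply/eqP; rewrite eq_le Ai0_le0 leNgt; apply/negP => Ai0_lt0.
pose w := \prod_k (if y0 (i0 k) == 0 then 1 else y0 (i0 k)).
have w_gt0 : 0 < w.
  by apply: prodr_gt0 => k _; case: eqP => // /eqP; rewrite lt0r y0_ge0 => ->.
pose K := \sum_i `|A i|.
have K_ge0 : 0 <= K by apply: sumr_ge0.
have bound e : 0 < e -> e <= 1 -> 0 <= e * K + A i0 * w.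
  move=> e_gt0 e_le1; pose z a := if y0 a == 0 then e else y0 a.
  have z_ge0 a : 0 <= z a by rewrite /z; case: ifP => // _; apply: ltW.
  have term i : A i * \prod_k z (i k) <= A i * \prod_k y0 (i k) + e ^+ m * `|A i|
      + (i == i0)%:R * (e ^+ m.-1 * (A i0 * w)).
    (* Three kinds of monomials: entirely off the support of [y0], entirely on it, and mixed. *)
    have [[l1 il1]|iT] := pselect (exists l, y0 (i l) != 0); last first.
      have iT0 l : y0 (i l) = 0.
        by apply/eqP; apply: contra_notT iT => il; exists l.
      have -> : i == i0 = false by apply: contraNF y0k1 => /eqP <-; rewrite iT0.
      rewrite mul0r addr0 [\prod_k y0 _](bigD1 k1) //= iT0 mul0r mulr0 add0r.
      under eq_bigr do rewrite /z iT0 eqxx.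
      rewrite prodr_const card_ord mulrC ler_wpM2l ?ler_norm //.
      by rewrite exprn_ge0 // ltW.
    have [[l2 il2]|iU] := pselect (exists l, y0 (i l) = 0); last first.
      have iU0 l : y0 (i l) == 0 = false.
        by apply/eqP => il; apply: iU; exists l.
      have -> : i == i0 = false.
        by apply: contraFF (iU0 k2) => /eqP ->; apply/eqP.
      under eq_bigr do rewrite /z iU0.
      by rewrite mul0r addr0 lerDl mulr_ge0 // exprn_ge0 // ltW.
    have Ai_le0 : A i <= 0.
      by apply: (@offdiag_le0 _ _ l1 l2) => //; apply: contraNneq il1 => ->; apply/eqP.
    rewrite [\prod_k y0 _](bigD1 l2) //= il2 mul0r mulr0 add0r.
    have em_ge0 : 0 <= e ^+ m * `|A i| by rewrite mulr_ge0 // exprn_ge0 // ltW.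
    have [ii0|_] := eqVneq i i0; last first.
      rewrite mul0r addr0; apply: le_trans em_ge0.
      by rewrite mulr_le0_ge0 // prodr_ge0.
    subst i; rewrite mul1r -[X in X <= _]add0r; apply: lerD => //.
    rewrite mulrCA ler_wnM2l //.
    have -> : \prod_k z (i0 k) = e ^+ (\sum_(k < m) (y0 (i0 k) == 0%R)) * w.
      rewrite -prodrXr -big_split; apply: eq_bigr => k _ /=.
      by rewrite /z; case: eqP; rewrite ?expr1 ?mulr1 ?mul1r.
    (* Position [k1] lies in the support, so at most m - 1 factors equal e. *)
    rewrite ler_wpM2r ?(ltW w_gt0) // ler_wiXn2l ?(ltW e_gt0) //.
    rewrite -ltnS prednK // -[X in (_ < X)%N]card_ord -sum1_card.
    rewrite [X in (X < _)%N](bigD1 k1) // [X in (_ < X)%N](bigD1 k1) //=.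
    rewrite (negbTE y0k1) add0n add1n ltnS.
    by apply: leq_sum => k _; case: eqP.
  have := le_trans (A_ge0 z) (ler_sum _ (fun i _ => term i)).
  rewrite !big_split /= -/(tform A y0) Ay0 add0r -mulr_sumr -/K.
  rewrite (bigD1 i0) //= eqxx mul1r big1 ?addr0; last first.
    by move=> i /negbTE ->; rewrite mul0r.
  rewrite -{1}(prednK m_gt0) exprSr -mulrA -mulrDr.
  by rewrite pmulr_rge0 // exprn_gt0.
pose c := - (A i0 * w).
have c_gt0 : 0 < c by rewrite oppr_gt0 nmulr_rlt0.
have d_gt0 : 0 < c + K + 1 by rewrite ltr_wpDl // addr_ge0 // ltW.
(* This e is at most 1 and satisfies e K < c, against [bound]. *)
have := bound (c / (c + K + 1)); rewrite divr_gt0 // ler_pdivrMr // mul1r.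
rewrite -addrA lerDl addr_ge0 // => /(_ isT isT).
rewrite addrA -[A i0 * w]opprK -/c subr_ge0 mulrAC ler_pdivlMr //.
rewrite ler_pM2l // leNgt -addrA [K + 1]addrC addrA ltrDr.
by rewrite addr_gt0.
Qed.

(* At a positive critical zero [y0], the first-order condition turns the form
   into a nonnegative combination of scaled AM-GM forms. *)
Lemma sosfun_critical N (Y : 'I_n -> 'rV[R]_N -> R) A y0 :
  (forall a, polyfun (Y a)) -> essentially_nonpositive A ->
  (forall a, 0 <= y0 a) ->
  (forall a, \sum_i (A i * \prod_k y0 (i k)) *+ deg_in a i = 0) ->
  sosfun (fun x => \sum_(i : tindex m n | [forall k, y0 (i k) != 0])
    A i * \prod_k Y (i k) x).
Proof.
(* If [y0 a] is zero, [t a] is the default 0; this is harmless, as [c i] then vanishes for each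
   monomial containing [a]. *)
move=> pY An y0_ge0 crit; pose t a x := Y a x / y0 a.
pose c (i : tindex m n) := A i * \prod_k y0 (i k).
pose D (i : tindex m n) x :=
  \sum_k t (i k) x ^+ m - m%:R * \prod_k t (i k) x.
have pt a : polyfun (t a) by apply: polyfunM => //; apply: polyfun_cst.
apply: (@eq_sosfun _ _ (fun x => \sum_i m%:R^-1 * (- c i * D i x))).
  move=> x; rewrite -mulr_sumr /D.
  under eq_bigr do rewrite mulrBr.
  rewrite sumrB; set S := (X in X - _).
  (* The coefficient of t_a^m in [S] is, up to sign, the left side of [crit] at [a]. *)
  have -> : S = 0.
    transitivity (- \sum_a t a x ^+ m * \sum_i c i *+ deg_in a i).
      rewrite -sumrN; under [RHS]eq_bigr do rewrite mulr_sumr -sumrN.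
      rewrite exchange_big; apply: eq_bigr => i _ /=.
      rewrite mulNr sumrN mulr_sumr; congr (- _).
      under [RHS]eq_bigr do rewrite mulrnAr mulrC -mulrnAr /deg_in -sumrMnr mulr_sumr.
      rewrite exchange_big; apply: eq_bigr => k _ /=.
      rewrite (bigD1 (i k)) //= eqxx mulr1n big1 ?addr0 // => a.
      by rewrite eq_sym => /negbTE ->; rewrite mulr0n mulr0.
    by rewrite big1 ?oppr0 // => a _; rewrite crit mulr0.
  rewrite sub0r -sumrN mulr_sumr [RHS]big_mkcond; apply: eq_bigr => i _ /=.
  rewrite mulNr opprK mulrCA mulKf; last by rewrite pnatr_eq0 -lt0n.
  case: ifPn => [/forallP iU|/forallPn [k]]; last first.
    by rewrite negbK /c => /eqP ik0; rewrite (bigD1 k) //= ik0 mul0r mulr0 mul0r.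
  rewrite /c -mulrA -big_split; congr (_ * _); apply: eq_bigr => k _ /=.
  by rewrite /t mulrC divfK.
apply: sosfun_sum => i _; apply: sosfun_scale; first by rewrite invr_ge0 ler0n.
(* On the diagonal, [D i] is identically zero whatever the sign of [A i]. *)
have [[a ia]|nd] := pselect (exists a : 'I_n, i = [ffun=> a]).
  apply: eq_sosfun (sosfun0 R N) => x.
  rewrite /D ia (prod_diag (t^~ x)).
  under eq_bigr do rewrite ffunE.
  by rewrite sumr_const card_ord mulr_natl subrr mulr0.
apply: sosfun_scale; last by apply: sosfun_hurwitz.
by rewrite -mulNr mulr_ge0 ?oppr_ge0 ?prodr_ge0 //; apply: An.
Qed.

Lemma tform_restrict A (S : {set 'I_n}) y :
  tform [ffun i : tindex m n => if [forall k, i k \in S] then A i else 0] y =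
  tform A (fun a => if a \in S then y a else 0).
Proof.
apply: eq_bigr => i _; rewrite ffunE; case: ifPn => [/forallP iS|/forallPn [k]].
  by congr (_ * _); apply: eq_bigr => k _; rewrite iS.
by move=> /negbTE iS; rewrite mul0r (bigD1 k) //= iS mul0r mulr0.
Qed.

(* Induction on the support [S]: subtracting the minimum [mu] of the form on
   the unit sphere of l^m leaves a form [B] that vanishes at the minimizer
   [y0 >= 0] and has no monomial mixing the support [U] of [y0] with its
   complement; on [U] the point [y0] is a positive critical zero. *)
Lemma sosfun_tform N (Y : 'I_n -> 'rV[R]_N -> R) A :
  (forall a, polyfun (Y a)) -> essentially_nonpositive A ->
  (forall y, 0 <= tform A y) -> sosfun (fun x => tform A (Y^~ x)).
Proof.
move=> pY.
suff ind j (S : {set 'I_n}) A' : (#|S| <= j)%N ->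
    (forall (i : tindex m n) k, i k \notin S -> A' i = 0) ->
    essentially_nonpositive A' ->
    (forall y, 0 <= tform A' y) -> sosfun (fun x => tform A' (Y^~ x)).
  by apply: (ind _ [set: 'I_n] A (leqnn _)) => i k; rewrite finset.in_setT.
elim: j S A' => [|j IHj] S {}A Sj AS An A_ge0.
all: have [S0|[a0 a0S]] := set_0Vmem S.
1,3: by apply: eq_sosfun (sosfun0 R N) => x; rewrite /tform big1 // => i _;
  rewrite (AS i (Ordinal m_gt0)) ?mul0r // S0 inE.
  by move: Sj; rewrite (cardsD1 a0) a0S.
have [y1 [y1S y11 y1min]] := tform_min A a0S.
(* Absolute values stay on the sphere and do not raise the form, so [y0] is also a minimizer. *)
pose y0 a := `|y1 a|; pose mu := tform A y0.
have y0_ge0 a : 0 <= y0 a by apply: normr_ge0.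
have y0S a : a \notin S -> y0 a = 0 by move=> aS; rewrite /y0 y1S ?normr0.
have y01 : \sum_(a in S) y0 a ^+ m = 1.
  rewrite -y11; apply: eq_bigr => a _.
  by rewrite /y0 -normrX ger0_norm // exprn_even_ge0.
have muP z : (forall a, a \notin S -> z a = 0) ->
    \sum_(a in S) z a ^+ m = 1 -> mu <= tform A z.
  by move=> zS z1; apply: le_trans (tform_norm _ An) (y1min _ zS z1).
pose B : tensor R m n := [ffun i => A i - mu * tdiag S i].
have BE y : tform B y = tform A y - mu * \sum_(a in S) y a ^+ m.
  rewrite -tform_tdiag /tform mulr_sumr -sumrB; apply: eq_bigr => i _.
  by rewrite ffunE mulrBl mulrA.
have BS (i : tindex m n) k : i k \notin S -> B i = 0.
  move=> iS; rewrite ffunE (AS i k iS) ffunE big1 ?mulr0 ?subrr // => a aS.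
  by case: eqP => // ia; move: iS; rewrite ia ffunE aS.
have Bn : essentially_nonpositive B.
  move=> i nd; rewrite 2!ffunE big1 ?mulr0 ?subr0; first exact: An.
  by move=> a _; case: eqP => // ia; case: nd; exists a.
have By0 : tform B y0 = 0 by rewrite BE y01 mulr1 subrr.
have B_ge0 y : 0 <= tform B y.
  rewrite BE; set s := \sum_(a in S) _.
  have s_ge0 : 0 <= s by apply: sumr_ge0 => a _; apply: exprn_even_ge0.
  have [s0|s_neq0] := eqVneq s 0; first by rewrite s0 mulr0 subr0.
  have s_gt0 : 0 < s by rewrite lt0r s_neq0.
  have [r r_ge0 rE] := exists_root_nneg m_gt0 s_ge0.
  (* Homogeneity: [z] is [y] restricted to [S], the only coordinates [A] sees, and rescaled to the
     sphere. *)
  pose z a := r^-1 * (if a \in S then y a else 0).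
  have Az : tform A z = s^-1 * tform A y.
    rewrite tform_scale exprVn rE -tform_restrict; congr (_ * _).
    apply: eq_bigr => i _; rewrite ffunE; case: ifPn => // /forallPn[k iS].
    by rewrite (AS i k iS).
  have := muP z; rewrite Az mulrC ler_pdivlMr // subr_ge0; apply.
    by move=> a /negbTE aS; rewrite /z aS mulr0.
  rewrite -[RHS](mulVf s_neq0) mulr_sumr; apply: eq_bigr => a aS.
  by rewrite /z aS exprMn exprVn rE.
have mu_ge0 : 0 <= mu by apply: A_ge0.
pose T := [set a in S | y0 a == 0].
pose BT : tensor R m n :=
  [ffun i : tindex m n => if [forall k, i k \in T] then B i else 0].
(* [T] is a proper subset of [S], because [y0] lies on the sphere and cannot vanish on all of
   [S]. *)
have sT : sosfun (fun x => tform BT (Y^~ x)).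
  apply: (IHj T) => [|i k iT|i nd|y]; last by rewrite tform_restrict.
  - rewrite -ltnS; apply: leq_trans Sj; apply: proper_card.
    have TS : T \subset S by apply/fintype.subsetP => a; rewrite inE => /andP[].
    rewrite finset.properEneq TS andbT; apply/eqP => TS'.
    move: y01; rewrite big1 => [/eqP|a]; first by rewrite eq_sym oner_eq0.
    by rewrite -TS' inE => /andP[_ /eqP ->]; rewrite expr0n eqn0Ngt m_gt0.
  - by rewrite ffunE; case: ifP => // /forallP/(_ k); rewrite (negbTE iT).
  - by rewrite ffunE; case: ifP => // _; apply: Bn.
have sU := sosfun_critical pY Bn y0_ge0 (tform_critical B_ge0 By0).
have smu : sosfun (fun x => mu * \sum_(a in S) Y a x ^+ m).
  apply: sosfun_scale => //; apply: sosfun_sum => a _.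
  apply: (@eq_sosfun _ _ (fun x => (Y a x ^+ m./2) ^+ 2)) => [x|].
    by rewrite -exprM muln2 even_halfK.
  by apply/sosfun_sqr/polyfunX.
apply: eq_sosfun (sosfunD (sosfunD sU sT) smu) => x.
transitivity (tform B (Y^~ x) + mu * \sum_(a in S) Y a x ^+ m); last first.
  by rewrite BE subrK.
(* Each entry of [B] is supported on U, supported on [T], or zero. *)
congr (_ + _); rewrite big_mkcond -big_split; apply: eq_bigr => i _ /=.
rewrite [BT i]ffunE; case: ifPn => [/forallP iU|/forallPn [k1]].
  case: ifPn => [/forallP/(_ (Ordinal m_gt0))|_]; last by rewrite mul0r addr0.
  by rewrite inE (negbTE (iU _)) andbF.
rewrite negbK add0r => /eqP ik1; case: ifPn => [//|/forallPn [k2]].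
rewrite inE negb_and => /orP[iS|ik2]; first by rewrite (BS _ _ iS).
by rewrite (tform_no_mixed Bn B_ge0 y0_ge0 By0 ik2 ik1).
Qed.

(** * Change of variables and linear combinations *)

(** The adjoint of the action of [P] is the transpose acting on vectors, which is right
    multiplication on rows; distributivity expands the product of sums. *)
Lemma tdot_tmul (P : 'M[R]_n) A (y : 'rV[R]_n) :
  tdot (tmul P A) (tpow m y) = tdot A (tpow m (y *m P)).
Proof.
rewrite !tdot_tpow /tform.
under eq_bigr do rewrite ffunE mulr_suml.
rewrite exchange_big; apply: eq_bigr => i _ /=.
under [\prod_k (y *m P) _ _]eq_bigr do rewrite mxE.
rewrite bigA_distr_bigA mulr_sumr; apply: eq_bigr => h _ /=.
by rewrite big_split /= mulrAC mulrC [_ * \prod_k P _ _]mulrC.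
Qed.

End TensorForms.

Lemma tform_comb (R : realType) m n (I : Type) (r : seq I) (Q : pred I)
    (A : tensor R m n) (c : I -> R) (B : I -> tensor R m n) (y : 'I_n -> R) :
  tform (A + \sum_(l <- r | Q l) tscale (c l) (B l)) y =
  tform A y + \sum_(l <- r | Q l) c l * tform (B l) y.
Proof.
rewrite /tform; under [X in _ = _ + X]eq_bigr do rewrite mulr_sumr.
rewrite exchange_big -big_split; apply: eq_bigr => i _ /=.
rewrite !ffunE sum_ffunE mulrDl mulr_suml; congr (_ + _).
by apply: eq_bigr => l _; rewrite ffunE mulrA.
Qed.

Lemma tsymmetric_comb (R : realType) m n (I : Type) (r : seq I) (Q : pred I)
    (A : tensor R m n) (c : I -> R) (B : I -> tensor R m n) :
  tsymmetric A -> (forall l, tsymmetric (B l)) ->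
  tsymmetric (A + \sum_(l <- r | Q l) tscale (c l) (B l)).
Proof.
move=> As Bs s i; rewrite !ffunE !sum_ffunE As; congr (_ + _).
by apply: eq_bigr => l _; rewrite !ffunE Bs.
Qed.

Lemma essentially_nonpositive_comb (R : realType) m n (I : Type) (r : seq I)
    (Q : pred I) (A : tensor R m n) (c : I -> R) (B : I -> tensor R m n) :
  essentially_nonpositive A -> (forall l, essentially_nonpositive (B l)) ->
  (forall l, Q l -> 0 <= c l) ->
  essentially_nonpositive (A + \sum_(l <- r | Q l) tscale (c l) (B l)).
Proof.
move=> An Bn c_ge0 i nd; rewrite !ffunE sum_ffunE -[leRHS]addr0.
apply: lerD; first exact: An.
by apply: sumr_le0 => l Ql; rewrite ffunE mulr_ge0_le0 ?c_ge0 //; apply: Bn.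
Qed.

(** * Equivalence of constrained nonnegativity and the certificate *)

Theorem corollary3p2 (R : realType) (n p m : nat)
    (n_gt0 : (0 < n)%N) (p_gt0 : (0 < p)%N)
    (m_gt0 : (0 < m)%N) (m_even : ~~ odd m)
    (F : 'I_p.+1 -> tensor R m n)
    (F_sym : forall l : 'I_p.+1, tsymmetric (F l))
    (F_essnonpos : exists P : 'M[R]_n,
       P \in unitmx /\
       forall l : 'I_p.+1, essentially_nonpositive (tmul P (F l)))
    (slater : exists x0 : 'rV[R]_n,
       forall l : 'I_p.+1, l != ord0 -> tdot (F l) (tpow m x0) < 0) :
  (forall x : 'rV[R]_n,
     (forall l : 'I_p.+1, l != ord0 -> tdot (F l) (tpow m x) <= 0) ->
     0 <= tdot (F ord0) (tpow m x))
  <->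
  (exists lambda : 'I_p.+1 -> R,
     (forall l : 'I_p.+1, l != ord0 -> 0 <= lambda l) /\
     SOS (F ord0 + \sum_(l < p.+1 | l != ord0) tscale (lambda l) (F l))).
Proof.
have [P [Pu Gn]] := F_essnonpos.
have FE l x : tdot (F l) (tpow m x) =
    tform (tmul P (F l)) ((x *m invmx P) ord0).
  by rewrite -tdot_tpow tdot_tmul -mulmxA mulVmx // mulmx1.
split=> [F0_ge0|[lambda [lambda_ge0 [_ [s sE]]]] x Fx]; last first.
  have : 0 <= tdot (F ord0 + \sum_(l < p.+1 | l != ord0)
      tscale (lambda l) (F l)) (tpow m x).
    by rewrite sE; apply: sumr_ge0 => q _; apply: sqr_ge0.
  rewrite tdot_tpow tform_comb -tdot_tpow => /le_trans; apply.
  rewrite gerDl; apply: sumr_le0 => l l0.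
  by rewrite -tdot_tpow mulr_ge0_le0 ?lambda_ge0 ?Fx.
(* Absolute values let [y] range over the whole space while the forms are evaluated on the orthant,
   where they are convex-like. *)
pose h l (y : 'rV[R]_n) := tform (tmul P (F l)) (fun a => `|y ord0 a|).
(* Arbitrary nonnegative weights are allowed: the forms are homogeneous of degree 1 in the z_a. *)
have h_cvx s t y z : 0 <= s -> 0 <= t -> exists w,
    h ord0 w <= s * h ord0 y + t * h ord0 z /\
    forall j : 'I_p, h (lift ord0 j) w <=
      s * h (lift ord0 j) y + t * h (lift ord0 j) z.
  move=> s_ge0 t_ge0.
  have [w w_ge0 wP] := tform_convexlike m_gt0 Gn s_ge0 t_ge0
    (fun a => normr_ge0 (y ord0 a)) (fun a => normr_ge0 (z ord0 a)).
  have hw l : h l (\row_a w a) = tform (tmul P (F l)) w.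
    by apply: eq_tform => a; rewrite mxE ger0_norm.
  by exists (\row_a w a); split=> [|l]; rewrite hw; apply: wP.
have h_slater : exists y, forall j : 'I_p, h (lift ord0 j) y < 0.
  have [x0 Fx0] := slater; exists (x0 *m invmx P) => j.
  apply: le_lt_trans (tform_norm m_even _ (Gn _)) _.
  by rewrite -FE; apply: Fx0; rewrite eq_sym neq_lift.
have h0_ge0 y : (forall j : 'I_p, h (lift ord0 j) y <= 0) -> 0 <= h ord0 y.
  move=> hy; pose x := (\row_a `|y ord0 a|) *m P.
  have hE l : h l y = tdot (F l) (tpow m x).
    by rewrite FE mulmxK //; apply: eq_tform => a; rewrite mxE.
  rewrite hE; apply: F0_ge0 => l; rewrite -hE.
  by case: (unliftP ord0 l) => [j|] -> // _; apply: hy.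
have [mu [mu_ge0 muP]] := convexlike_multipliers h_cvx h_slater h0_ge0.
(* The value at [ord0] is a dummy, excluded from the sums. *)
pose lambda l := if unlift ord0 l is Some j then mu j else 0.
have lambda_ge0 l : 0 <= lambda l by rewrite /lambda; case: unlift.
exists lambda; split=> //; split; first exact: tsymmetric_comb.
pose H := tmul P (F ord0) +
  \sum_(l < p.+1 | l != ord0) tscale (lambda l) (tmul P (F l)).
have Hn : essentially_nonpositive H by apply: essentially_nonpositive_comb.
(* At |y| the form of [H] is the Lagrangian bounded by [muP], and passing from |y| to y does not
   decrease it. *)
have H_ge0 y : 0 <= tform H y.
  apply: le_trans (tform_norm m_even y Hn); rewrite tform_comb.
  have hE l : h l (\row_a y a) = tform (tmul P (F l)) (fun a => `|y a|).
    by apply: eq_tform => a; rewrite mxE.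
  apply: le_trans (muP (\row_a y a)) _; rewrite hE lerD2l le_eqVlt.
  rewrite [X in _ == X]big_mkcond big_ord_recl eqxx /= add0r.
  apply/orP; left; apply/eqP; apply: eq_bigr => j _.
  by rewrite hE /lambda liftK.
(* The new coordinates are linear in x, so squares in them are squares of polynomials in x. *)
have pY a : polyfun (fun x : 'rV[R]_n => (x *m invmx P) ord0 a).
  suff : polyfun (fun x : 'rV[R]_n => \sum_b x ord0 b * invmx P b a).
    by move=> [q qE]; exists q => x; rewrite mxE qE.
  apply: polyfun_sum => b _.
  by apply: polyfunM; [apply: polyfun_coord | apply: polyfun_cst].
apply: eq_sosfun (sosfun_tform m_gt0 m_even pY Hn H_ge0) => x.
rewrite tdot_tpow !tform_comb -tdot_tpow FE; congr (_ + _).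
by apply: eq_bigr => l _; rewrite -tdot_tpow FE.
Qed.
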